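(* Let $\Omega\subset\mathbb{R}^3$ be a domain with a fixed (known) partition $(\Omega_m)_{m=1}^M$. Let $$\mu=\sum_{m=1}^M\mu_m 1_{\Omega_m},\qquad D=\sum_{m=1}^M D_m 1_{\Omega_m},\qquad \Gamma=\sum_{m=1}^M\Gamma_m 1_{\Omega_m}$$ with positive constants $\mu_m,D_m,\Gamma_m$, let $u$ be a corresponding fluence and $\mathcal{H}=\Gamma\mu u$ the corresponding initial pressure (as specified in the context), and assume that on every interface $I_{mn}\subset\Omega$ there exists a point $x$ with $$\nabla u_n(x)\cdot\nu(x)\neq 0$$ (equivalently, by the transmission condition, $\nabla u_m(x)\cdot\nu(x)\ne0$), where $\nu(x)$ is a normal vector of $I_{mn}$ at $x$. Suppose that $(\mu_n,D_n,\Gamma_n)$ is known for some $n\in\{1,\dots,M\}$. Then the parameters $\mu,D,\Gamma$ are uniquely determined by $\mathcal{H}$. That is: if $(\mu,D,\Gamma,u)$ and $(\tilde\mu,\tilde D,\tilde\Gamma,\tilde u)$ are two sets of parameters and fluences with the same partition $(\Omega_m)_{m=1}^M$, where $\mu=\sum_{m=1}^M\mu_m 1_{\Omega_m}$, $D=\sum_{m=1}^M D_m 1_{\Omega_m}$, $\Gamma=\sum_{m=1}^M\Gamma_m 1_{\Omega_m}$ and $\tilde\mu=\sum_{m=1}^M\tilde\mu_m 1_{\Omega_m}$, $\tilde D=\sum_{m=1}^M\tilde D_m 1_{\Omega_m}$, $\tilde\Gamma=\sum_{m=1}^M\tilde\Gamma_m 1_{\Omega_m}$ with positive constants $\mu_m,D_m,\Gamma_m,\tilde\mu_m,\tilde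 D_m,\tilde\Gamma_m$, where $u$ is a fluence corresponding to $(\mu,D)$ and $\tilde u$ is a fluence corresponding to $(\tilde\mu,\tilde D)$, and where on every interface $I_{mn}\subset\Omega$ there exist a point $x$ with $\nabla u_n(x)\cdot\nu(x)\neq0$ and a (possibly different) point $\tilde x$ with $\nabla\tilde u_n(\tilde x)\cdot\nu(\tilde x)\neq0$, such that $\Gamma\mu u=\tilde\Gamma\tilde\mu\tilde u$ in $\bigcup_m\Omega_m$ and $(\mu_n,D_n,\Gamma_n)=(\tilde\mu_n,\tilde D_n,\tilde\Gamma_n)$ for some $n$, then $(\mu_m,D_m,\Gamma_m)=(\tilde\mu_m,\tilde D_m,\tilde\Gamma_m)$ for all $m=1,\dots,M$.
   Context: Partition: $\Omega_1,\dots,\Omega_M$ are finitely many pairwise disjoint piecewise-$C^1$ domains contained in the (connected, open) set $\Omega$ with $\overline\Omega=\bigcup_{m=1}^M\overline\Omega_m$. Let $T$ be the part of $\bigcup_m\partial\Omega_m$ where the boundary is $C^1$ and which lies in the closure of at most two subregions; it is assumed that $\bigcup_m\partial\Omega_m\setminus T$ has zero surface ($2$-dimensional Hausdorff) measure. For $m\neq n$, the set $I_{mn}=\partial\Omega_m\cap\partial\Omega_n$, considered inside $\Omega$, is called an interface when it has positive surface measure. Fluence corresponding to $(\mu,D)$: a function $u$ on $\overline\Omega$, strictly positive and bounded from above on $\overline\Omega$, with $u\in C^\alpha(\overline\Omega)$ for some $\alpha>0$, such that, writing $u_m:=u|_{\Omega_m}$, (i) $u_m\in C^\infty(\Omega_m)$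 and $D_m\Delta u_m-\mu_m u_m=0$ in $\Omega_m$ for every $m$; (ii) at almost every point (with respect to surface measure) of every interface $I_{mn}$, the gradients $\nabla u_m$ and $\nabla u_n$ extend continuously (from inside $\Omega_m$, resp. $\Omega_n$) to that point, and the transmission condition $D_m\nabla u_m\cdot\nu=D_n\nabla u_n\cdot\nu$ holds there for any normal vector $\nu$ of the interface. The values of $u_m,\nabla u_m$ on $\partial\Omega_m$ denote these continuous extensions from inside $\Omega_m$. The point $x$ required on each interface is understood to be one of the points of the interface at which a normal exists, both gradients extend continuously and the transmission condition holds. *)

(* Defs.v *)
From HB Require Import structures.
From mathcomp Require Import all_boot all_order all_algebra.
From mathcomp Require Import all_classical all_reals all_analysis.

Set Implicit Arguments.
Unset Strict Implicit.
Unset Printing Implicit Defensive.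

Import Order.TTheory GRing.Theory Num.Theory.
Import numFieldNormedType.Exports.

Local Open Scope classical_set_scope.
Local Open Scope ring_scope.

Section Euclidean.
Context {R : realType} {d : nat}.

(* The library's norm on row vectors is the sup norm: it induces the usual
   topology, but lengths and diameters have to be Euclidean. *)
Definition dotp (x y : 'rV[R]_d) : R := \sum_i x 0 i * y 0 i.

Definition enorm (x : 'rV[R]_d) : R := Num.sqrt (dotp x x).

(* Adding 0 to the supremum makes the diameter of the empty set 0, not -oo. *)
Definition ediam (A : set 'rV[R]_d) : \bar R :=
  ereal_sup ([set 0%E] `|`
    [set r | exists x y, [/\ A x, A y & r = (enorm (x - y))%:E]]).

(* Two-dimensional Hausdorff outer measure, normalised by (area of the unit
   disc) / 2^2 so that it is surface area on C^1 surfaces. *)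
Definition hausdorff2_size (delta : R) (A : set 'rV[R]_d) : \bar R :=
  ereal_inf [set r | exists F : nat -> set 'rV[R]_d,
    [/\ A `<=` \bigcup_k F k,
        (forall k, (ediam (F k) <= delta%:E)%E) &
        r = (\sum_(0 <= k <oo) ((pi / 4)%:E * (ediam (F k) * ediam (F k))))%E]].

Definition hausdorff2 (A : set 'rV[R]_d) : \bar R :=
  ereal_sup [set r | exists2 delta : R,
    0 < delta & r = hausdorff2_size delta A].

Definition holder_on (alpha : R) (A : set 'rV[R]_d) (f : 'rV[R]_d -> R) : Prop :=
  exists C : R, forall x y, A x -> A y ->
    `|f x| <= C /\ `|f x - f y| <= C * enorm (x - y) `^ alpha.

End Euclidean.

Section Calculus.
Context {R : realType}.
Local Notation space := 'rV[R]_3.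

Definition pderiv (i : 'I_3) (f : space -> R) : space -> R :=
  fun x => 'D_(delta_mx 0 i) f x.

Definition grad (f : space -> R) (x : space) : space := \row_i pderiv i f x.

Definition laplacian (f : space -> R) (x : space) : R :=
  \sum_i pderiv i (pderiv i f) x.

(* C^k on an open set U: all partial derivatives of order at most k exist and
   are continuous on U. *)
Fixpoint Ck_on (k : nat) (U : set space) (f : space -> R) : Prop :=
  (forall x, U x -> {for x, continuous f}) /\
  (if k is k'.+1 then
     (forall i x, U x -> derivable f x (delta_mx 0 i)) /\
     (forall i, Ck_on k' U (pderiv i f))
   else True).

Definition smooth_on (U : set space) (f : space -> R) : Prop :=
  forall k, Ck_on k U f.

End Calculus.

Section Domains.
Context {R : realType}.
Local Notation space := 'rV[R]_3.

Definition domain (A : set space) : Prop := [/\ open A, connected A & A !=set0].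

Definition bdry (A : set space) : set space := closure A `\` interior A.

(* Near x, the set A lies on one side of the C^1 surface [g = 0]. *)
Definition C1_boundary_at (A : set space) (x : space) : Prop :=
  bdry A x /\
  exists (U : set space) (g : space -> R),
    [/\ open U, U x, Ck_on 1 U g, grad g x != 0 &
        forall y, U y -> (A y <-> g y < 0)].

(* The boundary is made up of C^1 pieces together with limit points of these
   (edges, corners), the latter having zero surface measure. *)
Definition piecewise_C1_domain (A : set space) : Prop :=
  [/\ domain A,
      bdry A `<=` closure (C1_boundary_at A) &
      hausdorff2 (bdry A `\` C1_boundary_at A) = 0%E].

(* Near x, the set S is a C^1 surface, and nu is a (nonzero, not necessarily
   unit) normal vector of S at x. *)
Definition normal_vector (S : set space) (x nu : space) : Prop :=
  S x /\
  exists (U : set space) (g : space -> R) (c : R),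
    [/\ open U, U x, Ck_on 1 U g, grad g x != 0 &
        [/\ forall y, U y -> (S y <-> g y = 0), c != 0 & nu = c *: grad g x]].

End Domains.

Section Partition.
Context {R : realType} {M : nat}.
Local Notation space := 'rV[R]_3.
Variables (Om : set space) (Omega : 'I_M -> set space).

Definition all_bdries : set space := \bigcup_m bdry (Omega m).

(* The set T of boundary points at which the boundary is C^1 and which lie in
   the closure of at most two subregions. *)
Definition regular_bdry : set space :=
  [set x | [/\ all_bdries x,
               forall m, bdry (Omega m) x -> C1_boundary_at (Omega m) x &
               exists m n, forall k, closure (Omega k) x -> k = m \/ k = n]].

Definition is_partition : Prop :=
  [/\ forall m, piecewise_C1_domain (Omega m),
      forall m, Omega m `<=` Om,
      forall m n, m != n -> Omega m `&` Omega n = set0,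
      closure Om = \bigcup_m closure (Omega m) &
      hausdorff2 (all_bdries `\` regular_bdry) = 0%E].

Definition common_bdry (m n : 'I_M) : set space :=
  bdry (Omega m) `&` bdry (Omega n) `&` Om.

Definition is_interface (m n : 'I_M) : Prop :=
  m != n /\ (0 < hausdorff2 (common_bdry m n))%E.

Definition pwconst (c : 'I_M -> R) (x : space) : R :=
  \sum_m c m * \1_(Omega m) x.

(* p is the value at x of the gradient of u restricted to Omega_m, extended
   continuously from inside Omega_m. *)
Definition grad_ext (u : space -> R) (m : 'I_M) (x p : space) : Prop :=
  grad u y @[y --> within (Omega m) (nbhs x)] --> p.

Definition transmission_at (D : 'I_M -> R) (u : space -> R) (m n : 'I_M)
    (x : space) : Prop :=
  exists p q : space,
    [/\ grad_ext u m x p, grad_ext u n x q &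
        forall nu, normal_vector (common_bdry m n) x nu ->
          D m * dotp p nu = D n * dotp q nu].

(* Only the values of u on the closure of Om are constrained. *)
Definition fluence (mu D : 'I_M -> R) (u : space -> R) : Prop :=
  [/\ forall x, closure Om x -> 0 < u x,
      exists C : R, forall x, closure Om x -> u x <= C,
      exists alpha : R, 0 < alpha <= 1 /\ holder_on alpha (closure Om) u,
      forall m, smooth_on (Omega m) u /\
        forall x, Omega m x -> D m * laplacian u x - mu m * u x = 0 &
      forall m n, is_interface m n ->
        hausdorff2 [set x | common_bdry m n x /\ ~ transmission_at D u m n x]
          = 0%E].

Definition nonvanishing_flux (D : 'I_M -> R) (u : space -> R) : Prop :=
  forall m n, is_interface m n ->
    exists x nu q : space,
      [/\ common_bdry m n x, transmission_at D u m n x,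
          normal_vector (common_bdry m n) x nu, grad_ext u n x q &
          dotp q nu != 0].

Definition initial_pressure (mu Gam : 'I_M -> R) (u : space -> R) (x : space) : R :=
  pwconst Gam x * pwconst mu x * u x.

End Partition.

(* Main.v *)
(* On each subregion u' is a constant multiple of u, and continuity makes the
   constants agree across an interface. So if the parameters agree on one side
   of an interface, then u = u' on both sides; comparing the two transmission
   conditions where the flux does not vanish gives D, the equation gives mu,
   and the pressure gives Gam. Two points need measure theory: the two
   transmission conditions must be compared at the same point, although each
   one holds only almost everywhere, and one must reach every subregion by
   crossing interfaces, that is, a set of zero surface measure must not
   separate the connected open set Om. Both follow from the fact that a
   projection of a set of zero 2-dimensional Hausdorff measure to a plane is
   Lebesgue null, so that among the lines parallel to a given direction and
   close to a given one, some miss the set. *)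
Require Import Defs.
From HB Require Import structures.
From mathcomp Require Import all_boot all_order all_algebra.
From mathcomp Require Import all_classical all_reals all_analysis.
From mathcomp Require Import ring lra.

Set Implicit Arguments.
Unset Strict Implicit.
Unset Printing Implicit Defensive.

Import Order.TTheory GRing.Theory Num.Theory.
Import numFieldNormedType.Exports.

Local Open Scope classical_set_scope.
Local Open Scope ring_scope.

(** * Surface-null sets have null projections to planes *)

Section HausdorffNull.
Context {R : realType}.
Local Notation space := 'rV[R]_3.
Local Notation leb2 := ((@lebesgue_measure R) \x (@lebesgue_measure R))%E.

Lemma coord_le_enorm (d : nat) (x : 'rV[R]_d) i : `|x 0 i| <= enorm x.
Proof.
rewrite /enorm -sqrtr_sqr ler_sqrt.
  by rewrite /dotp (bigD1 i)//= -expr2 lerDl sumr_ge0// => j _; rewrite -expr2 sqr_ge0.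
by apply: sumr_ge0 => j _; rewrite -expr2 sqr_ge0.
Qed.

Lemma ediam_ge0 (d : nat) (A : set 'rV[R]_d) : (0 <= ediam A)%E.
Proof. by apply: ereal_sup_ubound; left. Qed.

Lemma enorm_le_ediam (d : nat) (A : set 'rV[R]_d) x y : A x -> A y ->
  ((enorm (x - y))%:E <= ediam A)%E.
Proof. by move=> Ax Ay; apply: ereal_sup_ubound; right; exists x, y. Qed.

Lemma hausdorff2_ge0 (d : nat) (A : set 'rV[R]_d) : (0 <= hausdorff2 A)%E.
Proof.
apply: (@le_trans _ _ (hausdorff2_size 1 A)); last first.
  by apply: ereal_sup_ubound; exists 1.
apply: le_ereal_inf_tmp => _ [F [_ _ ->]].
apply: nneseries_ge0 => n _ _; rewrite !mule_ge0 ?ediam_ge0//.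
by rewrite lee_fin divr_ge0// pi_ge0.
Qed.

(** Scale 1 suffices because [hausdorff2] is a supremum over scales; the diameter bound keeps every
    [ediam] finite. *)
Lemma hausdorff2_null_cover (d : nat) (Z : set 'rV[R]_d) (e : R) :
  hausdorff2 Z = 0%E -> 0 < e -> exists F : nat -> set 'rV[R]_d,
  [/\ Z `<=` \bigcup_k F k, forall k, (ediam (F k) <= 1%:E)%E &
   (\sum_(0 <= k <oo) ((pi / 4)%:E * (ediam (F k) * ediam (F k))) < e%:E)%E].
Proof.
move=> Z0 e0.
have : (hausdorff2_size 1 Z < e%:E)%E.
  apply: (@le_lt_trans _ _ (hausdorff2 Z)); last by rewrite Z0 lte_fin.
  by apply: ereal_sup_ubound; exists 1.
by move=> /ereal_inf_lt[_ [F [ZF Fd ->]] Fe]; exists F.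
Qed.

Lemma leb2_square (c1 c2 rho : R) : 0 <= rho ->
  leb2 (`[c1 - rho, c1 + rho] `*` `[c2 - rho, c2 + rho]) = ((2 * rho) ^+ 2)%:E.
Proof.
move=> r0.
have L c : lebesgue_measure `[c - rho, c + rho]%classic = (2 * rho)%:E.
  rewrite lebesgue_measure_itv/= lte_fin; case: ltP => h.
    by rewrite -EFinB; congr EFin; ring.
  suff -> : rho = 0 by rewrite mulr0.
  by apply/le_anti; rewrite r0 andbT; move: h => /=; lra.
rewrite product_measure1E//; transitivity ((2 * rho)%:E * (2 * rho)%:E)%E.
  by apply: (f_equal2 mule); exact: L.
by rewrite -EFinM.
Qed.

(* The projection along d onto the coordinate plane x_i = 0 (junk if d_i = 0). *)
Definition shadow (i : 'I_3) (d x : space) : R * R :=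
  let y := x - (x 0 i / d 0 i) *: d in
  (y 0 (lift i ord0), y 0 (lift i ord_max)).

Lemma shadow_lipschitz (i : 'I_3) (d : space) : d 0 i != 0 ->
  exists2 K : R, 0 < K & forall x y,
    `|(shadow i d x).1 - (shadow i d y).1| <= K * enorm (x - y) /\
    `|(shadow i d x).2 - (shadow i d y).2| <= K * enorm (x - y).
Proof.
move=> di.
have key j (x y : space) : `|(x - (x 0 i / d 0 i) *: d) 0 j - (y - (y 0 i / d 0 i) *: d) 0 j|
    <= (1 + `|d 0 j / d 0 i|) * enorm (x - y).
  rewrite !mxE.
  have -> : x 0 j - x 0 i / d 0 i * d 0 j - (y 0 j - y 0 i / d 0 i * d 0 j) =
    (x - y) 0 j - (d 0 j / d 0 i) * (x - y) 0 i by rewrite !mxE; field.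
  rewrite (le_trans (ler_normB _ _))// mulrDl mul1r lerD ?coord_le_enorm// normrM.
  by rewrite ler_wpM2l ?coord_le_enorm.
exists (1 + `|d 0 (lift i ord0) / d 0 i| + `|d 0 (lift i ord_max) / d 0 i|) => [|x y].
  by rewrite -addrA ltr_pwDl// addr_ge0.
have n0 : 0 <= enorm (x - y) by apply: sqrtr_ge0.
split; apply: (le_trans (key _ _ _)); apply: ler_wpM2r => //.
- by rewrite lerDl.
- by rewrite addrAC lerDl.
Qed.

(** The projection is Lipschitz, so each set of a cover casts its shadow into a square of side
    proportional to its diameter; the total area is at most a constant times the Hausdorff sum. *)
Lemma hausdorff2_null_shadow (i : 'I_3) (d : space) (Z : set space) :
  d 0 i != 0 -> hausdorff2 Z = 0%E -> leb2.-negligible (shadow i d @` Z).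
Proof.
move=> di Z0.
have [K K0 HK] := shadow_lipschitz di.
have cov (e : R) : 0 < e -> exists A : set (R * R),
    [/\ measurable A, shadow i d @` Z `<=` A & (leb2 A <= e%:E)%E].
  move=> e0.
  (* A square of half-side K diam has area 4 K^2 diam^2, which is 16 K^2 / pi times the summand (pi
     / 4) diam^2. *)
  have cpos : 0 < 16 * K ^+ 2 / pi by rewrite divr_gt0 ?pi_gt0// mulr_gt0// exprn_gt0.
  have e'0 : 0 < e / (16 * K ^+ 2 / pi) by rewrite divr_gt0.
  have [F [ZF Fd Fe]] := hausdorff2_null_cover Z0 e'0.
  pose rho k := K * fine (ediam (F k)).
  (* The centre comes from an arbitrary point of [F k], or from a default point if [F k] is
     empty. *)
  pose c k := shadow i d (get (F k)).
  pose Q k := `[(c k).1 - rho k, (c k).1 + rho k]%classic `*`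
              `[(c k).2 - rho k, (c k).2 + rho k]%classic.
  have Ff k : ediam (F k) \is a fin_num.
    by rewrite ge0_fin_numE ?ediam_ge0// (le_lt_trans (Fd k))// ltry.
  have rho0 k : 0 <= rho k by rewrite mulr_ge0 ?(ltW K0)// fine_ge0// ediam_ge0.
  have mQ k : measurable (Q k) by apply: measurableX.
  exists (\bigcup_k Q k); split.
  - exact: bigcupT_measurable.
  - move=> _ [x Zx <-]; have [k _ Fx] := ZF _ Zx; exists k => //.
    have Fg : F k (get (F k)) by apply: getI Fx.
    have le1 : enorm (x - get (F k)) <= fine (ediam (F k)).
      by rewrite -lee_fin fineK// enorm_le_ediam.
    have [h1 h2] := HK x (get (F k)).
    have le2 : K * enorm (x - get (F k)) <= rho k by rewrite ler_wpM2l// ltW.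
    move: (le_trans h1 le2) (le_trans h2 le2); rewrite -/(c k) /Q.
    case: (shadow i d x) (c k) => [a b] [a' b'] /=.
    rewrite !ler_norml => /andP[? ?] /andP[? ?].
    by split => /=; rewrite in_itv/=; apply/andP; split; lra.
  - apply: (@le_trans _ _ (\sum_(0 <= k <oo) leb2 (Q k))%E).
      by apply: measure_sigma_subadditive => //; exact: bigcupT_measurable.
    have -> : (\sum_(0 <= k <oo) leb2 (Q k) = \sum_(0 <= k <oo)
      ((16 * K ^+ 2 / pi)%:E * ((pi / 4)%:E * (ediam (F k) * ediam (F k)))))%E.
      apply: eq_eseriesr => k _.
      rewrite leb2_square// -(fineK (Ff k)) -!EFinM /rho; congr EFin.
      have : (pi : R) != 0 by rewrite gt_eqF ?pi_gt0.
      by move: (pi : R) => P PN; field.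
    rewrite nneseriesZl; last first.
      by move=> k _; rewrite !mule_ge0 ?ediam_ge0// lee_fin divr_ge0// pi_ge0.
    have -> : e%:E = ((16 * K ^+ 2 / pi)%:E * (e / (16 * K ^+ 2 / pi))%:E)%E.
      by rewrite -EFinM mulrCA divff ?mulr1// gt_eqF.
    by rewrite lee_pmul2l// ltW.
have /choice[A HA] (n : nat) : exists A : set (R * R),
    [/\ measurable A, shadow i d @` Z `<=` A & (leb2 A <= n.+1%:R^-1%:E)%E].
  by apply: cov; rewrite invr_gt0.
exists (\bigcap_n A n); split.
- by apply: bigcapT_measurable => n; case: (HA n).
- apply/eqP; rewrite eq_le measure_ge0 andbT.
  apply/lee_addgt0Pr => e e0; rewrite add0e.
  pose n := Num.truncn e^-1.
  apply: (@le_trans _ _ (n.+1%:R^-1%:E)%E).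
    have [mA _ le] := HA n; apply: le_trans le; apply: le_measure; rewrite ?inE//.
      by apply: bigcapT_measurable => k; case: (HA k).
    exact: bigcap_inf.
  rewrite lee_fin -[leRHS]invrK lef_pV2 ?posrE ?invr_gt0//.
  by rewrite ltW// truncnS_gt.
- by move=> x Zx n _; case: (HA n) => _ + _; exact.
Qed.

(** Otherwise the shadow of [Z] would contain a square of half-side r / 2 about the shadow of [p],
    which has positive area. *)
Lemma null_shadow_line (i : 'I_3) (d p : space) (r : R) (Z : set space) :
  d 0 i != 0 -> 0 < r -> leb2.-negligible (shadow i d @` Z) ->
  exists2 v : space, `|v| < r & forall t : R, ~ Z (p + v + t *: d).
Proof.
move=> di r0 Zn; apply: contrapT => H.
have [c cE] : exists c, c = shadow i d p by exists (shadow i d p).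
pose s := r / 2.
have s0 : 0 < s by rewrite divr_gt0.
pose Q := `[c.1 - s, c.1 + s]%classic `*` `[c.2 - s, c.2 + s]%classic.
have QZ : Q `<=` shadow i d @` Z.
  move=> [a b] []/=; rewrite !in_itv/= => /andP[a1 a2] /andP[b1 b2].
  (* With i-th coordinate 0, [v] makes (a, b) the shadow of [p + v]; moving along [d] does not
     change it. *)
  pose v : space := \row_j (if unlift i j is Some l then
     if l == ord0 then a - c.1 else b - c.2 else 0).
  have vi : v 0 i = 0 by rewrite mxE unlift_none.
  have v1 : v 0 (lift i ord0) = a - c.1 by rewrite mxE liftK.
  have v2 : v 0 (lift i ord_max) = b - c.2 by rewrite mxE liftK.
  have vr : `|v| < r.
    apply: (@le_lt_trans _ _ s); last by rewrite /s; lra.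
    have -> : `|v| = mx_norm v by [].
    rewrite mx_normrE; apply: bigmax_le => [|[k j] _]; first exact: ltW.
    rewrite ord1 mxE; case: unliftP => [l _|_]; last by rewrite normr0 ltW.
    by case: ifP => _; rewrite ler_norml; apply/andP; split; lra.
  apply: contrapT => nZ; apply: H; exists v => // t Zt; apply: nZ.
  exists (p + v + t *: d) => //.
  have sh j : (p + v + t *: d - ((p + v + t *: d) 0 i / d 0 i) *: d) 0 j =
     (p - (p 0 i / d 0 i) *: d) 0 j + v 0 j.
    by rewrite !mxE unlift_none; field.
  rewrite /shadow !sh v1 v2 cE /shadow/=; congr pair; ring.
have mQ : measurable Q by exact: measurableX.
case: Zn => N [mN N0 ZN].
have QN : (leb2 Q <= leb2 N)%E.
  by apply: le_measure; rewrite ?inE//; exact: subset_trans ZN.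
have : (((2 * s) ^+ 2)%:E <= 0%:E :> \bar R)%E.
  by rewrite -(leb2_square c.1 c.2 (ltW s0)); apply: le_trans QN _; rewrite N0.
by rewrite lee_fin leNgt exprn_gt0// mulr_gt0.
Qed.

End HausdorffNull.

(** * Connectedness, segments and boundaries *)

(** Otherwise the trace of [C1] on [A] is closed in [A] and, being the trace of the complement of
    [C2], also open, hence all of [A]. *)
Lemma connected_closed_cover (T : topologicalType) (A C1 C2 : set T) :
  connected A -> closed C1 -> closed C2 -> A `<=` C1 `|` C2 ->
  A `&` C1 !=set0 -> A `&` C2 !=set0 -> A `&` C1 `&` C2 !=set0.
Proof.
move=> Ac c1 c2 AC A1 [y [Ay Cy]]; apply: contrapT => /set0P/negP/negPn/eqP A12.
have AE : A `&` C1 = A.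
  apply: Ac => //; last by exists C1.
  exists (~` C2); first exact: closed_openC.
  rewrite eqEsubset; split=> x [Ax Cx]; split => //.
    by move=> C2x; rewrite -[False]/((set0 : set T) x) -A12.
  by case: (AC _ Ax).
by rewrite -[False]/((set0 : set T) y) -A12 AE.
Qed.

Section Segment.
Context {R : realType} {V : normedModType R}.

Lemma line_continuous (p d : V) : continuous (fun t : R => p + t *: d).
Proof.
move=> t; apply: cvgD; first exact: cvg_cst.
by apply: cvgZ; [exact: cvg_id|exact: cvg_cst].
Qed.

Lemma ball_segment (z p d : V) (e t : R) : 0 <= t <= 1 ->
  ball z e p -> ball z e (p + d) -> ball z e (p + t *: d).
Proof.
rewrite -!ball_normE/= => /andP[t0 t1] zp zq.
have -> : z - (p + t *: d) = (1 - t) *: (z - p) + t *: (z - (p + d)).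
  rewrite !opprD !addrA; move: (z - p) => w.
  by rewrite scalerBl scale1r scalerDr scalerN addrA subrK.
rewrite (le_lt_trans (ler_normD _ _))// !normrZ !ger0_norm ?subr_ge0//.
have : `|z - p| <= Num.max `|z - p| `|z - (p + d)| by rewrite le_max lexx.
have : `|z - (p + d)| <= Num.max `|z - p| `|z - (p + d)| by rewrite le_max lexx orbT.
have : Num.max `|z - p| `|z - (p + d)| < e by rewrite gt_max zp.
move: (Num.max _ _) => m me qm pm.
apply: le_lt_trans me; rewrite (_ : m = (1 - t) * m + t * m); last by ring.
by rewrite lerD// ler_wpM2l// subr_ge0.
Qed.

End Segment.

(** A point of the interior of [A] has [A] as a neighbourhood, which would have to meet [B]. *)
Lemma closure_disjoint_bdry (R : realType) (A B : set 'rV[R]_3) x :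
  open A -> A `&` B = set0 -> closure A x -> closure B x -> bdry A x.
Proof.
move=> oA AB Ax Bx; split => //; move: (oA); rewrite openE => oA' /interior_subset xA.
have [y [By Ay]] := Bx A (oA' _ xA).
by rewrite -[False]/((set0 : set 'rV[R]_3) y) -AB.
Qed.

(** * Reaching every subregion through interfaces *)

Section Propagation.
Context {R : realType} {M : nat}.
Local Notation space := 'rV[R]_3.
Local Notation leb2 := ((@lebesgue_measure R) \x (@lebesgue_measure R))%E.
Variables (Om : set space) (Omega : 'I_M -> set space).

Lemma shadow_bigcup_negligible (I : countType) (i : 'I_3) (d : space)
    (Z : I -> set space) :
  (forall k, leb2.-negligible (shadow i d @` Z k)) ->
  leb2.-negligible (shadow i d @` \bigcup_k Z k).
Proof.
move=> HZ.
pose W k := if unpickle k is Some j then shadow i d @` Z j else set0.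
have : leb2.-negligible (\bigcup_k W k).
  apply: negligible_bigcup => k; rewrite /W; case: unpickle => [j|]; first exact: HZ.
  exact: negligible_set0.
apply: negligibleS => _ [x [j _ Zx] <-].
by exists (pickle j) => //; rewrite /W pickleK; exists x.
Qed.

(** If P failed somewhere, a P-ball and a non-P-ball near a common limit point could be joined by a
    segment missing all common boundaries between the two kinds, which are null since none is an
    interface. Connectedness of the segment forbids this. *)
Lemma interface_propagation (P : 'I_M -> Prop) (n : 'I_M) :
  domain Om -> is_partition Om Omega ->
  (forall m k, is_interface Om Omega m k -> P k -> P m) ->
  P n -> forall m, P m.
Proof.
move=> [oOm cOm _] [domO subO disjO clO _] step Pn m; apply: contrapT => nPm.
have oO k : open (Omega k) by case: (domO k) => -[].
have neO k : Omega k !=set0 by case: (domO k) => -[].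
pose C (Q : 'I_M -> Prop) := \bigcup_(k in Q) closure (Omega k).
have cC Q : closed (C Q).
  by apply: closed_bigcup => [|k _]; [exact: finite_finset|exact: closed_closure].
have CU : Om `<=` C P `|` C (fun k => ~ P k).
  move=> x Ox; have : closure Om x by exact: subset_closure.
  rewrite clO => -[k _ xk].
  by have [Pk|nPk] := pselect (P k); [left|right]; exists k.
have CQ Q k : Q k -> Om `&` C Q !=set0.
  move=> Qk; have [x Ox] := neO k; exists x; split; first exact: subO Ox.
  by exists k => //; exact: subset_closure.
have [z [[Omz [a Pa za]] [b nPb zb]]] :=
  connected_closed_cover cOm (cC P) (cC _) CU (CQ _ _ Pn) (CQ _ m nPm).
(* Balls are convex, so segments with endpoints in this ball stay in [Om]. *)
have [e /= e0 Ome] : nbhs_ball z Om by apply/nbhs_ballP; exact: open_nbhs_nbhs.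
have near_pt k : closure (Omega k) z ->
    exists p r, [/\ 0 < r, ball p r `<=` Omega k & ball p r `<=` ball z e].
  move=> /(_ (ball z e) (nbhsx_ballx _ _ e0))[p [Op zp]].
  have : nbhs p (Omega k `&` ball z e).
    apply: filterI; first exact: open_nbhs_nbhs.
    by apply: open_nbhs_nbhs; split => //; exact: ball_open.
  move=> /nbhs_ballP[r /= r0 rp]; exists p, r; split => // y /rp[]//.
have [p [r1 [r10 pO pe]]] := near_pt _ za.
have [q [r2 [r20 qO qe]]] := near_pt _ zb.
have ab : a != b by apply/eqP => abE; apply: nPb; rewrite -abE.
have pq : q - p != 0.
  rewrite subr_eq0; apply/eqP => qp.
  rewrite -[False]/((set0 : set space) p) -(disjO _ _ ab); split.
    by apply: pO; exact: ballxx.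
  by rewrite -qp; apply: qO; exact: ballxx.
have [i di] : exists i, (q - p) 0 i != 0.
  apply: contrapT => H; move/eqP: pq; apply; apply/rowP => i; rewrite [RHS]mxE.
  by apply/eqP/negPn/negP => qpi; apply: H; exists i.
pose Z := \bigcup_(ab : 'I_M * 'I_M)
  [set x | [/\ ~ P ab.1, P ab.2 & common_bdry Om Omega ab.1 ab.2 x]].
have Zn : leb2.-negligible (shadow i (q - p) @` Z).
  apply: shadow_bigcup_negligible => -[k l] /=.
  have [[nPk Pl]|nkl] := pselect (~ P k /\ P l); last first.
    rewrite (_ : [set _ | _] = set0) ?image_set0; first exact: negligible_set0.
    by rewrite -subset0 => x /= [nPk Pl _]; apply: nkl.
  have : leb2.-negligible (shadow i (q - p) @` common_bdry Om Omega k l).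
    apply: hausdorff2_null_shadow => //.
    have kl : k != l by apply/eqP => klE; apply: nPk; rewrite klE.
    (* Positive measure would make the pair an interface, and [step] would yield [P k]. *)
    apply/eqP; rewrite eq_le hausdorff2_ge0 andbT leNgt; apply/negP => H.
    by apply: nPk; apply: (step k l).
  by apply: negligibleS; apply: image_subset => x [].
(* A shift shorter than both radii keeps the two endpoints in their balls. *)
have rr0 : 0 < Num.min r1 r2 by rewrite lt_min r10.
have [v vr vZ] := null_shadow_line p di rr0 Zn.
move: vr; rewrite lt_min => /andP[vr1 vr2].
have pv : ball p r1 (p + v) by rewrite -ball_normE/= opprD addrA subrr sub0r normrN.
have qv : ball q r2 (p + v + (q - p)).
  by rewrite -ball_normE/= (_ : _ - _ = - v) ?normrN//; apply/rowP => j; rewrite !mxE; ring.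
pose f (t : R) := p + v + t *: (q - p).
pose S := f @` `[0, 1]%classic.
have Sc : connected S.
  apply: connected_continuous_connected; first exact: segment_connected.
  by apply: continuous_subspaceT; exact: line_continuous.
have SOm : S `<=` Om.
  move=> _ [t + <-]; rewrite /= in_itv/= => t01; apply: Ome.
  by apply: ball_segment => //; [exact: pe|exact: qe].
(* The segment starts in a P-subregion and ends in a non-P one, so some point of it lies in closures
   of both kinds, hence in [Z]. *)
have [_ [[[t t01 <-] [k Pk tk]] [l nPl tl]]] : S `&` C P `&` C (fun k => ~ P k) !=set0.
  apply: connected_closed_cover => //; first exact: subset_trans SOm CU.
    exists (p + v); split; last by exists a => //; apply: subset_closure; exact: pO.
    by exists 0; rewrite /f ?scale0r ?addr0//= in_itv/= lexx ler01.
  exists (p + v + (q - p)); split; last by exists b => //; apply: subset_closure; exact: qO.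
  by exists 1; rewrite /f ?scale1r//= in_itv/= lexx ler01.
apply: (vZ t); exists (l, k) => //=; split => //.
have lk : l != k by apply/eqP => lkE; apply: nPl; rewrite lkE.
split; last first.
  by apply: SOm; exists t.
split; first by apply: closure_disjoint_bdry tl tk => //; exact: disjO.
by apply: closure_disjoint_bdry tk tl => //; apply: disjO; rewrite eq_sym.
Qed.

End Propagation.

(** * Null sets contain no piece of a C^1 surface *)

Section Surface.
Context {R : realType}.
Local Notation space := 'rV[R]_3.

Lemma rV_norm_lt (d : nat) (x : 'rV[R]_d) (e : R) : 0 < e ->
  (forall i, `|x 0 i| < e) -> `|x| < e.
Proof.
move=> e0 H; have -> : `|x| = mx_norm x by [].
by rewrite mx_normrE; apply: bigmax_lt => // -[i j] _; rewrite ord1; exact: H.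
Qed.

Lemma rV_coord_le_norm (d : nat) (x : 'rV[R]_d) i : `|x 0 i| <= `|x|.
Proof.
have -> : `|x| = mx_norm x by [].
by rewrite mx_normrE; apply: (@le_bigmax _ _ _ 0 (fun ij : 'I_1 * 'I_d => `|x ij.1 ij.2|) (0, i)).
Qed.

Lemma norm_delta_mx (d : nat) (i : 'I_d) : `|delta_mx 0 i : 'rV[R]_d| <= 1.
Proof.
have -> : `|delta_mx 0 i : 'rV[R]_d| = mx_norm (delta_mx 0 i : 'rV[R]_d) by [].
rewrite mx_normrE; apply: bigmax_le => // -[k j] _; rewrite mxE.
by case: (_ && _); rewrite ?normr1 ?normr0.
Qed.

(** Multiplied by the derivative, the difference quotient tends to a positive square, so it is
    positive at both steps t and -t, whatever the sign of the derivative. *)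
Lemma derive_sign_change (g : space -> R) (x v : space) (e : R) :
  derivable g x v -> g x = 0 -> 'D_v g x != 0 -> 0 < e ->
  exists2 t, 0 < t < e &
    0 < 'D_v g x * g (x + t *: v) /\ 'D_v g x * g (x + (- t) *: v) < 0.
Proof.
move=> dg gx0 D0 e0; set D := 'D_v g x.
have DD : 0 < D * D by rewrite -expr2 exprn_even_gt0.
have : D * (h^-1 *: ((g \o shift x) (h *: v) - g x)) @[h --> 0^'] --> D * D.
  by apply: cvgMl_tmp; exact: dg.
move=> /cvgr_gt/(_ 0 DD); rewrite /dnbhs/within/= => /nbhs_ballP[r /= r0 H].
pose t := Num.min (r / 2) (e / 2).
have t0 : 0 < t by rewrite lt_min !divr_gt0.
have tr : t < r by rewrite gt_min; apply/orP; left; lra.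
have te : t < e by rewrite gt_min; apply/orP; right; lra.
have key h : `|h| < r -> h != 0 -> 0 < D * (h^-1 * g (x + h *: v)).
  move=> hr h0; have := H h; rewrite -ball_normE/= sub0r normrN => /(_ hr h0).
  by rewrite gx0 subr0 addrC.
exists t; first by rewrite t0.
have h1 : 0 < D * (t^-1 * g (x + t *: v)).
  by apply: key; rewrite ?gtr0_norm// gt_eqF.
have h2 : 0 < D * ((- t)^-1 * g (x + (- t) *: v)).
  by apply: key; rewrite ?normrN ?gtr0_norm// oppr_eq0 gt_eqF.
split; first by move: h1; rewrite mulrCA pmulr_rgt0// invr_gt0.
by move: h2; rewrite mulrCA invrN mulNr oppr_gt0 pmulr_rlt0// invr_gt0.
Qed.

(* Over every line parallel to a coordinate direction transversal to the
   surface and close to x, the sign change of g produces a point of the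
   surface; a null set misses one of these lines. *)
Lemma C1_surface_not_null (U V Z : set space) (g : space -> R) (x : space) :
  open U -> U x -> Ck_on 1 U g -> grad g x != 0 -> g x = 0 ->
  nbhs x V -> hausdorff2 Z = 0%E ->
  exists y, [/\ U y, V y, g y = 0 & ~ Z y].
Proof.
move=> oU Ux [gC [gd _]] gx gx0 xV Z0.
have [i Di] : exists i, pderiv i g x != 0.
  apply: contrapT => H; move/eqP: gx; apply; apply/rowP => i; rewrite !mxE.
  by apply/eqP/negPn/negP => ?; apply: H; exists i.
have : nbhs x (U `&` V) by apply: filterI => //; exact: open_nbhs_nbhs.
move=> /nbhs_ballP[e /= e0 eUV].
have e20 : 0 < e / 2 by rewrite divr_gt0.
have [t /andP[t0 te] [gp gm]] := derive_sign_change (gd i x Ux) gx0 Di e20.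
rewrite -/(pderiv i g x) in gp gm; move: (pderiv i g x) Di gp gm => D D0 gp gm.
pose w : space := delta_mx 0 i.
have wn : `|w| <= 1 := norm_delta_mx i.
have near_x (v : space) (s : R) : `|v| < e / 2 -> `|s| < e / 2 -> ball x e (x + v + s *: w).
  move=> ve se; rewrite -ball_normE/= !opprD !addrA subrr sub0r.
  rewrite (le_lt_trans (ler_normB _ _))// normrN normrZ (splitr e) ltrD//.
  by apply: le_lt_trans se; rewrite ler_piMr.
have cont (v : space) (s : R) : `|v| < e / 2 -> `|s| < e / 2 ->
    {for x + v + s *: w, continuous g}.
  by move=> ve se; apply: gC; have [] := eUV _ (near_x v s ve se).
have tt : `|t| < e / 2 by rewrite gtr0_norm.
have tt' : `|- t| < e / 2 by rewrite normrN.
have n0 : `|0 : space| < e / 2 by rewrite normr0.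
(* The signs of [D * g] at the two ends survive a small shift [v] of the line. *)
have near_end (s : R) (Q : set R) : `|s| < e / 2 -> open Q -> Q (D * g (x + s *: w)) ->
    exists2 r, 0 < r & forall v : space, `|v| < r -> Q (D * g (x + v + s *: w)).
  move=> se oQ Qs.
  have cvg1 : g @ (x + s *: w) --> g (x + s *: w).
    by have := cont 0 s n0 se; rewrite addr0.
  have : D * g y @[y --> x + s *: w] --> D * g (x + s *: w).
    exact: (@cvgMl_tmp R _ (nbhs (x + s *: w)) _ g D _ cvg1).
  move=> /(_ Q (open_nbhs_nbhs (conj oQ Qs)))/nbhs_ballP[r /= r0 H].
  exists r => // v vr; apply: H; rewrite -ball_normE/= (_ : _ - _ = - v) ?normrN//.
  by rewrite (addrAC x v) opprD addrA subrr sub0r.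
have [r1 r10 H1] := near_end t _ tt (@open_gt R 0) gp.
have [r2 r20 H2] := near_end (- t) _ tt' (@open_lt R 0) gm.
have r0 : 0 < Num.min (e / 2) (Num.min r1 r2) by rewrite !lt_min e20 r10.
have wi : w 0 i != 0 by rewrite mxE !eqxx oner_eq0.
have [v vr vZ] := null_shadow_line x wi r0 (hausdorff2_null_shadow wi Z0).
move: vr; rewrite !lt_min => /and3P[ve vr1 vr2].
have fc : {within `[- t, t], continuous (fun s : R => D * g (x + v + s *: w))}.
  apply: continuous_in_subspaceT => s; rewrite inE/= in_itv/= => /andP[st1 st2].
  have se : `|s| < e / 2 by rewrite ltr_norml; apply/andP; split; lra.
  have gs : {for s, continuous (g \o (fun s : R => x + v + s *: w))}.
    by apply: continuous_comp; [exact: line_continuous|exact: cont].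
  exact: (@cvgMl_tmp R _ (nbhs s) _ _ D _ gs).
(* The zero found on the shifted line avoids [Z] because the whole line does. *)
have [||s] := IVT (v := 0) _ fc.
- by lra.
- rewrite ge_min le_max; apply/andP; split; apply/orP.
    by left; apply: ltW; exact: H2.
  by right; apply: ltW; exact: H1.
rewrite in_itv/= => /andP[st1 st2] /eqP; rewrite mulf_eq0 (negPf D0)/= => /eqP gs.
have se : `|s| < e / 2 by rewrite ltr_norml; apply/andP; split; lra.
by exists (x + v + s *: w); have [? ?] := eUV _ (near_x v s ve se).
Qed.

End Surface.

(** * Continuity of the transmission condition along an interface *)

Section Transmission.
Context {R : realType}.
Local Notation space := 'rV[R]_3.

Lemma dotp_cvg (T : Type) (F : set_system T) (FF : Filter F)
    (f g : T -> space) (p q : space) :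
  f @ F --> p -> g @ F --> q -> dotp (f z) (g z) @[z --> F] --> dotp p q.
Proof.
move=> fp gq; rewrite /dotp; apply: cvg_big => //; first exact: add_continuous.
have coord i (h : T -> space) (l : space) : h @ F --> l -> h z 0 i @[z --> F] --> l 0 i.
  by move=> hl; exact: cvg_comp hl (@coord_continuous R 1 3 0 i l).
by move=> i _; apply: cvgM; exact: coord.
Qed.

(** The difference of the two sides is jointly continuous in both gradients and the normal, so a
    failure persists nearby. *)
Lemma transmission_gap_open (a b : R) (p q nu : space) :
  a * dotp p nu != b * dotp q nu ->
  exists2 e, 0 < e & forall p' q' nu' : space,
    `|p - p'| < e -> `|q - q'| < e -> `|nu - nu'| < e ->
    a * dotp p' nu' != b * dotp q' nu'.
Proof.
rewrite -subr_eq0 => H.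
pose F (z : space * space * space) := a * dotp z.1.1 z.2 - b * dotp z.1.2 z.2.
have : F z @[z --> (p, q, nu)] --> F (p, q, nu).
  have c1 : (z.1.1 : space) @[z --> ((p, q), nu)] --> p.
    by apply: cvg_comp; [exact: cvg_fst|exact: cvg_fst].
  have c2 : (z.1.2 : space) @[z --> ((p, q), nu)] --> q.
    by apply: cvg_comp; [exact: cvg_fst|exact: cvg_snd].
  have c3 : (z.2 : space) @[z --> ((p, q), nu)] --> nu by exact: cvg_snd.
  by apply: cvgB; apply: cvgMl_tmp; exact: dotp_cvg.
move=> /cvgr_neq0/(_ H)/nbhs_ballP[e /= e0 He]; exists e => // p' q' nu' pp qq nn.
have /= := He (p', q', nu'); rewrite /F subr_eq0; apply.
by split; [split|] => /=; rewrite -ball_normE.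
Qed.

Lemma grad_near (U : set space) (g : space -> R) (x : space) (e : R) :
  Ck_on 1 U g -> U x -> 0 < e -> \forall y \near x, `|grad g x - grad g y| < e.
Proof.
move=> [_ [_ gC]] Ux e0.
have : \forall y \near x, forall i, `|pderiv i g x - pderiv i g y| < e.
  refine (@filter_forall _ _ (fun i y => `|pderiv i g x - pderiv i g y| < e) (nbhs x) _ _) => i.
  by have [+ _] := gC i; move=> /(_ x Ux)/cvgr_dist_lt/(_ _ e0).
by apply: filterS => y Hy; apply: rV_norm_lt => // i; rewrite !mxE.
Qed.

Section TwoSubregions.
Context {M : nat}.
Variables (Om : set space) (Omega : 'I_M -> set space).

(** A limit value [p'] at [y] is approximated by gradients at points inside the subregion near [y],
    and these are already close to [p]. *)
Lemma grad_ext_near (u : space -> R) (m : 'I_M) (x p : space) (e : R) :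
  grad_ext Omega u m x p -> 0 < e ->
  \forall y \near x, forall p', closure (Omega m) y -> grad_ext Omega u m y p' ->
    `|p - p'| < e.
Proof.
move=> up e0; have e20 : 0 < e / 2 by rewrite divr_gt0.
have : \forall y \near x, Omega m y -> `|p - grad u y| < e / 2.
  by have /cvgr_dist_lt/(_ _ e20) := up; rewrite near_withinE.
move=> /(nbhs_interior); apply: filterS => y Hy p' cy up'.
have PF : ProperFilter (within (Omega m) (nbhs y)) by apply: within_nbhs_proper.
have : \forall z \near within (Omega m) (nbhs y),
    `|p - grad u z| < e / 2 /\ `|p' - grad u z| < e / 2.
  apply: filterI; first exact: Hy.
  by move/cvgr_dist_lt: up'; exact.
move=> /filter_ex[z [pz p'z]]; rewrite (splitr e).
rewrite (_ : p - p' = (p - grad u z) - (p' - grad u z)).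
  by rewrite (le_lt_trans (ler_normB _ _))// ltrD.
by rewrite opprB addrA subrK.
Qed.

(* The transmission condition for v may fail at x itself, but it holds at
   points of the interface arbitrarily close to x, and both sides of it are
   continuous along the interface. *)
Lemma transmission_closed (a : 'I_M -> R) (v : space -> R) (m n : 'I_M)
    (x p q nu : space) :
  hausdorff2 [set y | common_bdry Om Omega m n y /\
                      ~ transmission_at Om Omega a v m n y] = 0%E ->
  normal_vector (common_bdry Om Omega m n) x nu ->
  grad_ext Omega v m x p -> grad_ext Omega v n x q ->
  a m * dotp p nu = a n * dotp q nu.
Proof.
move=> H0 [Sx [U [g [c [oU Ux gC gx [SU c0 nuE]]]]]] vp vq.
apply/eqP/negPn/negP => /transmission_gap_open[e e0 He].
(* The first bound puts [c *: grad g y] within e of [nu]; the second keeps [grad g y] nonzero. *)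
have gxe : 0 < Num.min (e / `|c|) `|grad g x|.
  by rewrite lt_min divr_gt0 ?normr_gt0.
have := C1_surface_not_null oU Ux gC gx ((SU x Ux).1 Sx) _ H0.
move=> /(_ _ (filterI (grad_ext_near vp e0) (filterI (grad_ext_near vq e0)
  (grad_near gC Ux gxe)))) [y [Uy [Vp [Vq Vg]] gy nb]].
have Sy : common_bdry Om Omega m n y by apply/SU.
have : transmission_at Om Omega a v m n y by apply: contrapT => nt; exact: nb.
move=> [p' [q' [vp' vq' T]]].
move: Vg; rewrite lt_min => /andP[Vg1 Vg2].
have gy0 : grad g y != 0.
  by apply/eqP => gy0; move: Vg2; rewrite gy0 subr0 ltxx.
have [[[cm _] [cn _]] _] := Sy.
have := He p' q' (c *: grad g y) (Vp _ cm vp') (Vq _ cn vq').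
rewrite nuE -scalerBr normrZ mulrC -ltr_pdivlMr ?normr_gt0// => /(_ Vg1).
(* The same [g] and [c] make [c *: grad g y] a normal vector at [y], where the condition holds. *)
rewrite T ?eqxx//; split => //.
by exists U, g, c; split.
Qed.

End TwoSubregions.
End Transmission.

(** * Boundary limits of fluences and locality of the operators *)

Section Fluence.
Context {R : realType}.
Local Notation space := 'rV[R]_3.

Lemma enorm_le_norm (d : nat) (x : 'rV[R]_d.+1) : enorm x <= d.+1%:R * `|x|.
Proof.
have n0 : 0 <= d.+1%:R * `|x| by rewrite mulr_ge0.
rewrite -(ger0_norm n0) -sqrtr_sqr /enorm ler_sqrt ?sqr_ge0//.
apply: (@le_trans _ _ (\sum_(i < d.+1) `|x| ^+ 2)).
  apply: ler_sum => i _; rewrite -expr2 -real_normK ?num_real//.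
  by rewrite lerXn2r ?nnegrE// rV_coord_le_norm.
rewrite sumr_const card_ord -[leLHS]mulr_natl exprMn ler_wpM2r ?sqr_ge0//.
by rewrite -natrX ler_nat expnS leq_pmulr// expn1.
Qed.

Lemma holder_on_cvg (d : nat) (alpha : R) (A B : set 'rV[R]_d.+1)
    (f : 'rV[R]_d.+1 -> R) (x : 'rV[R]_d.+1) :
  0 < alpha -> holder_on alpha B f -> A `<=` B -> B x ->
  f y @[y --> within A (nbhs x)] --> f x.
Proof.
move=> a0 [C HC] AB Bx; apply/cvgrPdist_lt => e e0; rewrite near_withinE.
(* The added 1 allows division by [K] even if C is 0; [r] solves K r^alpha = e. *)
pose K := `|C| + 1; have K0 : 0 < K by rewrite ltr_pwDr.
pose r := (e / K) `^ (alpha^-1).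
have r0 : 0 < r by rewrite powR_gt0// divr_gt0.
(* Dividing by the dimension passes from the Euclidean norm to the sup norm. *)
have rd : 0 < r / d.+1%:R by rewrite divr_gt0.
have : \forall y \near x, `|x - y| < r / d.+1%:R.
  by apply/nbhs_ballP; exists (r / d.+1%:R) => //= y; rewrite -ball_normE.
apply: filterS => y xy /AB By; have [_ le] := HC _ _ Bx By.
apply: (le_lt_trans le).
have en : enorm (x - y) < r.
  by rewrite (le_lt_trans (enorm_le_norm _))// mulrC -ltr_pdivlMr.
have er : enorm (x - y) `^ alpha < e / K.
  have -> : e / K = r `^ alpha.
    by rewrite -powRrM mulVf ?gt_eqF// powRr1// divr_ge0// ltW.
  by apply: gt0_ltr_powR; rewrite ?nnegrE ?sqrtr_ge0// ltW.
apply: (@le_lt_trans _ _ (K * enorm (x - y) `^ alpha)).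
  by rewrite ler_wpM2r ?powR_ge0// /K (le_trans (ler_norm C))// lerDl.
by rewrite mulrC -ltr_pdivlMr.
Qed.

Lemma grad_eq_on (A : set space) (f g : space -> R) :
  open A -> (forall y, A y -> f y = g y) -> forall y, A y -> grad f y = grad g y.
Proof.
move=> oA fg y Ay; apply/rowP => i; rewrite !mxE; apply: near_eq_derive.
by apply: filterS fg _; apply: open_nbhs_nbhs.
Qed.

Lemma laplacian_eq_on (A : set space) (f g : space -> R) :
  open A -> (forall y, A y -> f y = g y) -> forall y, A y -> laplacian f y = laplacian g y.
Proof.
move=> oA fg y Ay; apply: eq_bigr => i _; apply: near_eq_derive.
have : nbhs y A by apply: open_nbhs_nbhs.
apply: filterS => z Az.
by have /rowP/(_ i) := grad_eq_on oA fg Az; rewrite !mxE.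
Qed.

Lemma pwconst_in (M : nat) (Omega : 'I_M -> set space) (c : 'I_M -> R) m x :
  (forall k l, k != l -> Omega k `&` Omega l = set0) ->
  Omega m x -> pwconst Omega c x = c m.
Proof.
move=> disj Omx; rewrite /pwconst (bigD1 m)//= big1 ?addr0 => [|k km].
  by rewrite indicE mem_set// mulr1.
rewrite indicE memNset ?mulr0// => Okx.
by rewrite -[False]/((set0 : set space) x) -(disj _ _ km).
Qed.

End Fluence.

(** * Transfer of the parameters across one interface *)

Theorem proposition2 (R : realType) (M : nat)
    (Om : set 'rV[R]_3) (Omega : 'I_M -> set 'rV[R]_3)
    (mu D Gam mu' D' Gam' : 'I_M -> R) (u u' : 'rV[R]_3 -> R)
    (hOm : domain Om) (hpart : is_partition Om Omega)
    (hpos : forall m, [/\ 0 < mu m, 0 < D m & 0 < Gam m])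
    (hpos' : forall m, [/\ 0 < mu' m, 0 < D' m & 0 < Gam' m])
    (hu : fluence Om Omega mu D u)
    (hu' : fluence Om Omega mu' D' u')
    (hflux : nonvanishing_flux Om Omega D u)
    (hflux' : nonvanishing_flux Om Omega D' u')
    (hH : forall x, (\bigcup_m Omega m) x ->
      initial_pressure Omega mu Gam u x = initial_pressure Omega mu' Gam' u' x)
    (n : 'I_M)
    (hn : (mu n, D n, Gam n) = (mu' n, D' n, Gam' n)) :
  forall m, (mu m, D m, Gam m) = (mu' m, D' m, Gam' m).
Proof.
(* The parameters are known on side [k] and sought on side [m]. *)
apply: (interface_propagation hOm hpart) hn => m k hmk [muk Dk Gamk].
have [domO subO disj _ _] := hpart.
have [upos _ [alpha [/andP[a0 _] uh]] uPDE _] := hu.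
have [_ _ [alpha' [/andP[a0' _] uh']] uPDE' trans'] := hu'.
have oO l : open (Omega l) by case: (domO l) => -[].
have [x [nu [q [Sx [p [q' [up uq' T]]] nx uq qnu]]]] := hflux m k hmk.
have [[[cm _] [ck _]] Omx] := Sx.
have subc l : Omega l `<=` closure Om by move=> y /subO; exact: subset_closure.
have cx : closure Om x by exact: subset_closure.
have PF l : closure (Omega l) x -> ProperFilter (within (Omega l) (nbhs x)).
  by move=> cl; apply: within_nbhs_proper.
have HE l y : Omega l y -> Gam l * mu l * u y = Gam' l * mu' l * u' y.
  move=> Oy; have := hH y (ex_intro2 _ _ l I Oy).
  by rewrite /initial_pressure !(pwconst_in _ disj Oy).
(* The pressure identity passes to the limit at [x] from inside either subregion. *)
have HEx l : closure (Omega l) x -> Gam l * mu l * u x = Gam' l * mu' l * u' x.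
  move=> cl; have PFl := PF l cl.
  have c1 : Gam l * mu l * u y @[y --> within (Omega l) (nbhs x)] --> Gam l * mu l * u x.
    by apply: cvgMl_tmp; exact: (holder_on_cvg a0 uh (subc l) cx).
  have c2 : Gam' l * mu' l * u' y @[y --> within (Omega l) (nbhs x)] --> Gam' l * mu' l * u' x.
    by apply: cvgMl_tmp; exact: (holder_on_cvg a0' uh' (subc l) cx).
  have c3 : Gam l * mu l * u y @[y --> within (Omega l) (nbhs x)] --> Gam' l * mu' l * u' x.
    apply: cvg_trans c2; apply: near_eq_cvg; rewrite near_withinE.
    by apply: nearW => y Oy; rewrite HE.
  exact: cvg_unique c1 c3.
have prod0 l : Gam' l * mu' l != 0.
  by have [? ? ?] := hpos' l; rewrite mulf_neq0// gt_eqF.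
have ux : u x = u' x.
  by apply: (mulfI (prod0 k)); rewrite -HEx// Gamk muk.
(* Side [k] gave u = u' at [x]; read from side [m], positivity of u there lets the products be
   compared. *)
have prodE : Gam m * mu m = Gam' m * mu' m.
  by apply: (@mulIf _ (u x)); rewrite ?gt_eqF ?upos// {2}ux HEx.
have uE l : Gam l * mu l = Gam' l * mu' l -> forall y, Omega l y -> u y = u' y.
  by move=> E y Oy; apply: (mulfI (prod0 l)); rewrite -HE// E.
have uEm := uE m prodE.
have uEk : forall y, Omega k y -> u y = u' y by apply: uE; rewrite Gamk muk.
have gE l r : (forall y, Omega l y -> u y = u' y) ->
    grad_ext Omega u l x r -> grad_ext Omega u' l x r.
  move=> ul; apply: cvg_trans; apply: near_eq_cvg; rewrite near_withinE.
  by apply: nearW => y Oy; rewrite (grad_eq_on (oO l) ul Oy).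
(* This gives the condition for [u'] at the very point [x] chosen for [u], with the same
   gradients. *)
have T' := transmission_closed (trans' _ _ hmk) nx (gE _ _ uEm up) (gE _ _ uEk uq').
have qE : q' = q by have PFk := PF k ck; exact: cvg_unique uq' uq.
have pnu : dotp p nu != 0.
  apply/eqP => p0; move: (T nu nx); rewrite p0 mulr0 qE => /esym/eqP.
  by rewrite mulf_eq0 (negPf qnu) orbF gt_eqF//; case: (hpos k).
(* Both conditions have the same right-hand side as [D] agrees on side [k]; the nonzero flux
   cancels. *)
have DE : D m = D' m by apply: (mulIf pnu); rewrite T// T' Dk.
have [y Oy] : Omega m !=set0 by case: (domO m) => -[].
have muE : mu m = mu' m.
  (* With u and D shared on [Omega m], the two equations at one point [y] give equal products with u
     > 0. *)
  have yn : u y != 0 by rewrite gt_eqF// upos//; exact: subc Oy.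
  apply: (mulIf yn); have [_ /(_ y Oy)/eqP] := uPDE m.
  rewrite subr_eq0 => /eqP <-; have [_ /(_ y Oy)/eqP] := uPDE' m.
  by rewrite subr_eq0 -(uEm y Oy) -(laplacian_eq_on (oO m) uEm Oy) -DE => /eqP.
congr (_, _, _) => //; apply: (@mulIf _ (mu m)); last by rewrite prodE muE.
by have [? _ _] := hpos m; rewrite gt_eqF.
Qed.
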